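(* Let $G$ be a finite simple graph with girth at least $10$. Then $G$ is b-continuous, i.e., for every integer $k$ with $\chi(G)\le k\le b(G)$, the graph $G$ has a b-coloring with exactly $k$ colors.
   Context: A (proper) coloring of $G$ with $k$ colors is a map $\psi:V(G)\to\{1,\dots,k\}$ with $\psi(u)\neq\psi(v)$ whenever $uv\in E(G)$. A vertex $u$ is a b-vertex of $\psi$ if for every color $c\neq\psi(u)$ some neighbor of $u$ has color $c$. A b-coloring with $k$ colors is a coloring with $k$ colors in which every one of the $k$ color classes is nonempty and contains a b-vertex. The b-chromatic number $b(G)$ is the maximum $k$ such that $G$ has a b-coloring with $k$ colors. The girth of $G$ is the minimum length of a cycle in $G$ (infinite if $G$ is acyclic). $\chi(G)$ is the chromatic number. *)

(* Defs.v *)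
From mathcomp Require Import all_boot.

Set Implicit Arguments.
Unset Strict Implicit.
Unset Printing Implicit Defensive.

Record sgraph := SGraph {
  vertex :> finType;
  edge : rel vertex;
  edge_sym : symmetric edge;
  edge_irrefl : irreflexive edge }.

Section Girth.
Variable G : sgraph.

(* A graph cycle is given by the list of its distinct vertices; the bound on
   the size is needed because a single edge is a ucycle of size 2. *)
Definition graph_cycle (c : seq G) : bool :=
  (2 < size c) && ucycleb (@edge G) c.

Definition has_cycle_of_length (n : nat) : bool :=
  [exists c : n.-tuple G, graph_cycle c].

(* None stands for infinite girth. The vertices of a cycle being distinct, no
   cycle is longer than #|G|, and the head of the increasing list of all cycle
   lengths is their minimum. *)
Definition girth : option nat :=
  ohead [seq n <- iota 0 #|G|.+1 | has_cycle_of_length n].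

Definition girth_at_least (g : nat) : bool :=
  if girth is Some n then g <= n else true.

Lemma girth_at_leastP g :
  reflect (forall c : seq G, graph_cycle c -> g <= size c) (girth_at_least g).
Proof.
have cycP n : reflect (exists2 c : seq G, graph_cycle c & size c = n)
                      (has_cycle_of_length n).
  apply: (iffP existsP) => [[c gc]|[c gc sc]]; first by exists c; rewrite ?size_tuple.
  by exists (tcast sc (in_tuple c)); rewrite val_tcast.
have size_cyc (c : seq G) : graph_cycle c -> size c \in
    [seq n <- iota 0 #|G|.+1 | has_cycle_of_length n].
  move=> gc; rewrite mem_filter mem_iota add0n ltnS /=; apply/andP; split.
    by apply/cycP; exists c.
  by case/and3P: gc => _ _ /card_uniqP <-; apply: max_card.
rewrite /girth_at_least /girth.
have: sorted ltn [seq n <- iota 0 #|G|.+1 | has_cycle_of_length n].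
  by apply: sorted_filter (iota_ltn_sorted _ _) => ? ? ?; apply: ltn_trans.
case Es: [seq n <- _ | _] => [|n s] /= srt; apply: (iffP idP) => //.
- by move=> _ c /size_cyc; rewrite Es.
- move=> gn c /size_cyc; rewrite Es inE => /predU1P[-> //|ss].
  have /allP/(_ _ ss) : all (ltn n) s by apply: order_path_min srt; apply: ltn_trans.
  by move=> /= /ltnW; apply: leq_trans.
- move=> H; have: n \in n :: s by rewrite mem_head.
  by rewrite -Es mem_filter => /andP[/cycP[c /H ? <-]].
Qed.

End Girth.

Section Coloring.
Variable G : sgraph.

Section Colors.
Variable k : nat.

Definition proper_coloring (psi : {ffun G -> 'I_k}) : bool :=
  [forall u, forall v, edge u v ==> (psi u != psi v)].

Definition b_vertex (psi : {ffun G -> 'I_k}) (u : G) : bool :=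
  [forall c, (c != psi u) ==> [exists v, edge u v && (psi v == c)]].

Definition b_coloring (psi : {ffun G -> 'I_k}) : bool :=
  proper_coloring psi && [forall c, exists u, (psi u == c) && b_vertex psi u].

Definition colorable : bool := [exists psi, proper_coloring psi].

Definition b_colorable : bool := [exists psi, b_coloring psi].

End Colors.

Lemma ex_colorable : exists k, colorable k.
Proof.
exists #|G|; apply/existsP; exists [ffun u => enum_rank u].
apply/forallP => u; apply/forallP => v; apply/implyP => uv; rewrite !ffunE.
by apply: contraTneq uv => /enum_rank_inj ->; rewrite edge_irrefl.
Qed.

Definition chromatic_number : nat := ex_minn ex_colorable.

Lemma chromatic_number_b_colorable : b_colorable chromatic_number.
Proof.
rewrite /chromatic_number; case: ex_minnP => n /existsP[psi psiP] n_min.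
apply/existsP; exists psi; rewrite /b_coloring psiP /=.
apply/forallP => c; apply: contraT => /existsPn noB.
case: n => [|n] in psi psiP n_min c noB *; first by case: c noB.
pose free u c' := (c' != c) && [forall v, edge u v ==> (psi v != c')].
pose f u := if psi u == c then odflt c [pick c' | free u c'] else psi u.
have fP u : psi u = c -> free u (f u).
  move=> uc; rewrite /f uc eqxx; case: pickP => //= nofree.
  case/negP: (noB u); rewrite uc eqxx; apply/forallP => c'; apply/implyP => cc'.
  move/negbT: (nofree c'); rewrite /free -{1}uc cc' negb_forall.
  case/existsP=> v; rewrite negb_imply negbK => ?.
  by apply/existsP; exists v.
have fc u : c != f u.
  rewrite eq_sym; have [/fP/andP[]//|uc] := eqVneq (psi u) c.
  by rewrite /f (negPf uc).
suff /n_min : colorable n by rewrite ltnn.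
apply/existsP; exists [ffun u => s2val (unlift_some (fc u))].
apply/forallP => u; apply/forallP => v; apply/implyP => uv; rewrite !ffunE.
suff: f u != f v.
  case: (unlift_some (fc u)) => i /= fu _; case: (unlift_some (fc v)) => j /= fv _.
  by rewrite fu fv; apply: contra_neq => ->.
have pr x y : edge x y -> psi x != psi y.
  by move: psiP => /forallP/(_ x)/forallP/(_ y)/implyP.
have vu : edge v u by rewrite edge_sym.
have [uc|uc] := eqVneq (psi u) c.
  have vc : psi v != c by rewrite -uc eq_sym pr.
  have /andP[_ /forallP/(_ v)] := fP u uc.
  by rewrite uv /= [f v]/f (negPf vc) eq_sym.
have [vc|vc] := eqVneq (psi v) c.
  have /andP[_ /forallP/(_ u)] := fP v vc.
  by rewrite vu /= [f u]/f (negPf uc).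
by rewrite /f (negPf uc) (negPf vc) pr.
Qed.

Lemma ex_b_colorable : exists k, b_colorable k.
Proof. by exists chromatic_number; apply: chromatic_number_b_colorable. Qed.

Lemma b_colorable_leq k : b_colorable k -> k <= #|G|.
Proof.
case/existsP=> psi /andP[_ /forallP sur].
have inj : injective (fun c => xchoose (existsP (sur c))).
  move=> c c' E; have /andP[/eqP <- _] := xchooseP (existsP (sur c)).
  by have /andP[/eqP <- _] := xchooseP (existsP (sur c')); rewrite E.
by have := leq_card _ inj; rewrite card_ord.
Qed.

Definition b_chromatic_number : nat := ex_maxn ex_b_colorable b_colorable_leq.

Definition b_continuous : Prop :=
  forall k, chromatic_number <= k <= b_chromatic_number -> b_colorable k.

End Coloring.

(* Main.v *)
(** It suffices to turn a b-coloring with k + 1 colors into one with k colors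
    when k > chi(G). Treat one of the colors as superfluous and recolor as many
    of its vertices as possible, keeping a b-vertex for each of the k others. If
    a superfluous vertex u remains, then for every color i it has a neighbor w_i
    of color i that either has degree at least k - 1 or is adjacent to one of
    the chosen b-vertices y_i, again of degree at least k - 1. As the girth is
    at least 10, the ball of radius 3 around u is a tree, a vertex outside it
    has at most one neighbor in it, and those that have one are pairwise
    non-adjacent. Color the ball with k colors so that the w_i, the y_i or u
    become b-vertices of all k colors, color the rest with k - 1 >= chi(G)
    colors, and give color k to the outside vertices in conflict with the
    ball. *)

Require Import Defs.
From mathcomp Require Import all_boot zify.

Set Implicit Arguments.
Unset Strict Implicit.
Unset Printing Implicit Defensive.

(** * Short walks in a graph of large girth *)

(* Non-backtracking walks; those with at most 10 vertices are paths when the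
   girth is at least 10, which is the only way in which the girth is used. *)
Fixpoint nb_walk (G : sgraph) (s : seq G) : bool :=
  if s is x :: t then
    if t is y :: t' then [&& edge x y, Some x != ohead t' & nb_walk t] else true
  else true.

Lemma nb_walk_path (G : sgraph) (x : G) s : nb_walk (x :: s) -> path (@edge G) x s.
Proof. by elim: s x => //= y s IH x /and3P[-> _ /IH]. Qed.

Lemma nb_walk_behead (G : sgraph) (x : G) s : nb_walk (x :: s) -> nb_walk s.
Proof. by case: s => //= y s /and3P[]. Qed.

(** The stretch between two visits to a vertex would be a cycle on at most 9 vertices; the absence
    of loops and backtracking gives it at least 3. *)
Lemma nb_walk_uniq (G : sgraph) (s : seq G) :
  girth_at_least G 10 -> size s <= 10 -> nb_walk s -> uniq s.
Proof.
move=> /girth_at_leastP gG; elim: s => // x s IH /= ss nb.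
rewrite IH ?andbT; [|lia|exact: nb_walk_behead nb].
have us : uniq s by apply: IH; [lia|exact: nb_walk_behead nb].
apply/negP => /splitPr sx; case: sx ss nb us => p q ss nb us {IH}.
have pth := nb_walk_path nb.
have /gG : graph_cycle (x :: p); last by move: ss; rewrite size_cat /=; lia.
apply/and3P; split.
- case: p nb {ss us pth} => [|y [|z p]] //=; first by rewrite edge_irrefl.
  by rewrite eqxx andbF.
- by move: pth; rewrite cat_path /= rcons_path => /and3P[-> ->].
- by move: us; rewrite -cat_rcons cat_uniq rcons_uniq => /andP[].
Qed.

Lemma nb_walk_catrev (G : sgraph) (v : G) s t :
  nb_walk (v :: s) -> nb_walk (v :: t) -> (s = [::] \/ ohead s != ohead t) ->
  nb_walk (catrev s (v :: t)).
Proof.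
elim: s v t => //= p s IH v t /and3P[vp vs ps] vt [//|pt].
apply: IH => //; last by right; rewrite eq_sym.
by rewrite /= edge_sym vp pt.
Qed.

(** Where the walks part, the reverse of one followed by the other is a non-backtracking walk on at
    most 10 vertices that visits the common end twice. *)
Lemma nb_walk_inj (G : sgraph) (v : G) s t :
  girth_at_least G 10 -> nb_walk (v :: s) -> nb_walk (v :: t) ->
  last v s = last v t -> size s + size t <= 9 -> s = t.
Proof.
move=> gG; have closed (x : G) r : nb_walk (x :: r) -> size r <= 9 -> last x r = x -> r = [::].
  case: r => // y r nb sr l; have := nb_walk_uniq gG (_ : size (x :: y :: r) <= 10) nb.
  by move=> /(_ sr); rewrite cons_uniq -{1}l /= mem_last.
elim: s v t => [|p s IH] v [|q t] // ns nt.
- by move=> /esym l sz; rewrite (closed _ _ nt) //.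
- by move=> l sz; rewrite (closed _ _ ns) //; move: sz => /=; lia.
have [Epq|pq] := eqVneq p q.
  move: nt; rewrite -Epq => nt l sz; congr (_ :: _).
  apply: (IH p t (nb_walk_behead ns) (nb_walk_behead nt) l).
  by move: sz => /=; lia.
move=> l sz; have nb : nb_walk (catrev (p :: s) (v :: q :: t)).
  by apply: nb_walk_catrev => //; right.
move: nb; rewrite catrevE => /(nb_walk_uniq gG).
rewrite size_cat size_rev addnS => /(_ sz).
rewrite cat_uniq => /and3P[_ /hasP[]]; exists (last v (q :: t)).
  exact: mem_last.
by rewrite -l /= mem_rev mem_last.
Qed.

(** * Extending a coloring of the ball of radius 3 *)

(* [C] colors a vertex of the ball of radius 3 around [u] through the unique
   non-backtracking walk, of at most 4 vertices, from that vertex to [u]. *)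
Lemma ball_coloring_extends (G : sgraph) m (phi : {ffun G -> 'I_m}) (u : G)
    (C : seq G -> 'I_m.+1) :
  girth_at_least G 10 -> proper_coloring phi ->
  (forall v p s, nb_walk [:: v, p & s] -> last p s = u -> size s <= 2 ->
     C [:: v, p & s] != C (p :: s)) ->
  exists2 psi : {ffun G -> 'I_m.+1}, proper_coloring psi &
    forall v s, nb_walk (v :: s) -> last v s = u -> size s <= 3 ->
      psi v = C (v :: s).
Proof.
move=> gG phiP Cp.
have phi_neq x y : edge x y -> phi x != phi y.
  by move: phiP => /forallP/(_ x)/forallP/(_ y)/implyP.
pose isw v (s : seq G) := [&& nb_walk (v :: s), last v s == u & size s <= 3].
pose W v : option (seq G) :=
  omap val [pick s : 3.-bseq G | nb_walk (v :: s) && (last v s == u)].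
(* Since 3 + 3 <= 9 the walk to [u] is unique, so the choice made by [pick] does not matter. *)
have WP v s : W v = Some s <-> isw v s.
  rewrite /W; case: pickP => [b /andP[nb /eqP lb]|no]; split.
  - by move=> [<-]; rewrite /isw nb lb eqxx size_bseq.
  - move=> /and3P[ns /eqP ls ss]; congr Some.
    apply: (nb_walk_inj gG nb ns); rewrite ?lb ?ls //.
    by have := size_bseq b; lia.
  - by [].
  - by move=> /and3P[ns ls ss]; have /negP[] := negbT (no (Bseq ss)); apply/andP.
pose conflict v :=
  [exists x, edge v x && (if W x is Some s then C (x :: s) == lift ord_max (phi v) else false)].
pose psi v := if W v is Some s then C (v :: s) else
  if conflict v then ord_max else lift ord_max (phi v).
have ext x v s : W v = None -> edge v x -> W x = Some s -> nb_walk [:: v, x & s].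
  move=> Wv vx /WP /and3P[ns ls ss]; apply/and3P; split=> //.
  apply/eqP; case: s ns ls ss => // y s ns ls ss [vy]; subst y.
  suff: W v = Some s by rewrite Wv.
  by apply/WP; apply/and3P; split=> //; [exact: nb_walk_behead ns|exact: ltnW].
have inout v x s : edge v x -> W v = None -> W x = Some s -> psi v != psi x.
  move=> vx Wv Wx; have nv := ext _ _ _ Wv vx Wx.
  rewrite /psi Wv Wx; case: ifPn => [/existsP[x' /andP[vx']]|].
    case Wx': (W x') => [s'|//] /eqP Cx'.
    have nv' := ext _ _ _ Wv vx' Wx'.
    move/WP: Wx => /and3P[ns /eqP ls ss]; move/WP: Wx' => /and3P[ns' /eqP ls' ss'].
    (* Both walks from [v] have length at most 4, so [v] has a single neighbor in the ball. *)
    have [<- <-] : x' :: s' = x :: s.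
      by apply: (nb_walk_inj gG nv' nv) => /=; [rewrite ls ls'|lia].
    by rewrite Cx' neq_lift.
  by move=> /existsPn/(_ x); rewrite vx Wx eq_sym.
exists [ffun v => psi v]; last first.
  by move=> v s ns ls ss; rewrite ffunE /psi (_ : W v = Some s) //; apply/WP; rewrite /isw ns ls eqxx.
apply/forallP => v; apply/forallP => x; apply/implyP => vx; rewrite !ffunE.
have xv : edge x v by rewrite edge_sym.
case Wv: (W v) => [s|]; case Wx: (W x) => [t|].
(* The walks of [v] and [x] cannot each start towards the other vertex; by symmetry that of [v] does
   not, and it extends to that of [x]. *)
- wlog tv : v x s t vx xv Wv Wx / ohead s != Some x => [hw|].
    have [sx|] := eqVneq (ohead s) (Some x); last exact: hw Wx.
    rewrite eq_sym; apply: (hw x v t s) => //; apply/eqP => tv.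
    case: s sx Wv => //= _ s [->] /WP /and3P[ns /eqP ls ss].
    case: t tv Wx => //= _ t [->] /WP /and3P[nt /eqP lt st].
    have nv : nb_walk (v :: t) by exact: nb_walk_behead nt.
    have Et : t = x :: s.
      by apply: (nb_walk_inj gG nv ns); [rewrite ls|move: ss st => /=; lia].
    by move: nt; rewrite Et /= eqxx andbF.
  move/WP: (Wv) => /and3P[ns /eqP ls ss]; move/WP: (Wx) => /and3P[nt /eqP lt st].
  have nx : nb_walk [:: x, v & s] by apply/and3P; split=> //; rewrite eq_sym.
  have Et : t = v :: s by apply: (nb_walk_inj gG nt nx); rewrite ?lt //=; lia.
  rewrite /psi Wv Wx Et eq_sym; apply: Cp => //.
  by move: st; rewrite Et.
- by rewrite eq_sym; apply: inout Wv.
- exact: inout Wx.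
rewrite /psi Wv Wx; case: ifPn => [|_]; case: ifPn => [|_]; rewrite ?neq_lift //.
- move=> /existsP[x' /andP[xx']]; case Wx': (W x') => [t|//] _.
  move=> /existsP[v' /andP[vv']]; case Wv': (W v') => [s|//] _.
  have nx := ext _ _ _ Wx xx' Wx'; have nv := ext _ _ _ Wv vv' Wv'.
  move/WP: (Wx') => /and3P[_ /eqP lx sx]; move/WP: (Wv') => /and3P[_ /eqP lv sv].
  have nxv : nb_walk [:: x, v, v' & s].
    apply/and3P; split=> //.
    by apply/eqP => -[xv']; rewrite xv' Wv' in Wx.
  (* Lengths up to 4 and 5 add up to 9, all that girth 10 allows. *)
  have [Ex _] : x' :: t = v :: v' :: s.
    by apply: (nb_walk_inj gG nx nxv) => /=; [rewrite lx lv|lia].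
  by rewrite Ex Wv in Wx'.
- by rewrite eq_sym neq_lift.
- by rewrite (inj_eq lift_inj) phi_neq.
Qed.

(** * A coloring of the ball with prescribed b-vertices *)

(** Deals the colors of [D] out along the enumeration of [A], with a default once they are
    exhausted; for nonempty [D], [spread set0 D v] is just some color of [D]. *)
Definition spread (T : finType) m (A : {set T}) (D : {set 'I_m.+1}) (v : T) :=
  nth (odflt ord0 [pick x in D]) (enum D) (index v (enum A)).

Lemma spread_in (T : finType) m (A : {set T}) (D : {set 'I_m.+1}) v :
  D != set0 -> spread A D v \in D.
Proof.
case/set0Pn=> d Dd; have dD : odflt ord0 [pick x in D] \in D.
  by case: pickP => [//|/(_ d)]; rewrite Dd.
rewrite /spread; have [lt|ge] := ltnP (index v (enum A)) (size (enum D)).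
  by rewrite -mem_enum mem_nth.
by rewrite nth_default.
Qed.

Lemma spread_onto (T : finType) m (A : {set T}) (D : {set 'I_m.+1}) c :
  #|D| <= #|A| -> c \in D -> exists2 v, v \in A & spread A D v = c.
Proof.
move=> DA cD; have lt : index c (enum D) < size (enum A).
  by rewrite -cardE; apply: leq_trans DA; rewrite cardE index_mem mem_enum.
have [x _] : exists x, x \in A.
  by apply/card_gt0P; apply: leq_trans DA; apply/card_gt0P; exists c.
exists (nth x (enum A) (index c (enum D))); first by rewrite -mem_enum mem_nth.
by rewrite /spread index_uniq ?enum_uniq // nth_index // mem_enum.
Qed.

(* The b-vertex of color [i] will be [w i] if [I i] holds and [y i] otherwise;
   the only exception is that, when [I] is everywhere true, the color [a] of [u]
   has b-vertex [u]. *)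
Section Iris.
Variables (G : sgraph) (m : nat) (u : G).
Variables (I : pred 'I_m.+1) (w y : 'I_m.+1 -> G).
Hypothesis m_gt1 : 1 < m.
Hypothesis w_inj : injective w.
Hypothesis uw : forall i, edge u (w i).
Hypothesis w_deg : forall i, I i -> m <= #|[set v | edge (w i) v]|.
Hypothesis wy : forall i, ~~ I i -> edge (w i) (y i) /\ y i != u.
Hypothesis y_deg : forall i, ~~ I i -> m <= #|[set v | edge (y i) v]|.
Variable a : 'I_m.+1.
Hypothesis a_center : ~~ I a \/ forall i, I i.

Let children (p q : G) := [set v | edge p v & v != q].
Let other (i j : 'I_m.+1) := ~: [set i; j].

(** [w i] takes [i] if it is to be the b-vertex; otherwise it leaves [i] to its child [y i] or, if
    [I i] holds, to [u]. *)
Let color1 x :=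
  if [pick i | w i == x] is Some i then
    if I i && (i != a) then i else spread set0 (other a i) x
  else spread set0 (other a a) x.

(** Apart from the [y i], children of [x] are dealt the colors that neither [u] nor [x] has, so that
    [w i] sees every other color when [I i] holds. *)
Let color2 v x :=
  if [pick i | [&& ~~ I i, w i == x & y i == v]] is Some i then i
  else spread (children x u) (other a (color1 x)) v.

Let color3 z v x := spread (children v x) (other (color1 x) (color2 v x)) z.

Let color s :=
  match s with
  | [:: z, v, x & _ :: _] => color3 z v x
  | [:: v; x; _] => color2 v x
  | [:: x; _] => color1 x
  | _ => a
  end.

Let other_neq0 i j : other i j != set0.
Proof.
rewrite -card_gt0 /other cardsCs setCK card_ord cards2.
by case: eqP => _ /=; lia.
Qed.

Let spread_neq A i j (v : G) :
  (spread A (other i j) v != i) && (spread A (other i j) v != j).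
Proof. by have := spread_in A v (other_neq0 i j); rewrite !inE negb_or. Qed.

(** Dropping the parent leaves at least m - 1 neighbors, and the m + 1 colors without [i] and [j]
    are m - 1. *)
Let children_onto p q i j c : edge p q -> m <= #|[set v | edge p v]| ->
  i != j -> c != i -> c != j ->
  exists v, [/\ edge p v, v != q & spread (children p q) (other i j) v = c].
Proof.
move=> pq dp ij ci cj.
have [||v] := @spread_onto _ _ (children p q) (other i j) c.
- rewrite /other cardsCs setCK card_ord cards2 ij.
  move: dp; rewrite (cardsD1 q) inE pq /children.
  rewrite (_ : _ :\ q = [set v | edge p v & v != q]); first by lia.
  by apply/setP => v; rewrite !inE andbC.
- by rewrite !inE negb_or ci.
by rewrite inE => /andP[]; exists v.
Qed.

Let color1_neq_a x : color1 x != a.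
Proof.
rewrite /color1; case: pickP => [i _|_]; last by case/andP: (spread_neq set0 a a x).
by case: ifP => [/andP[]|_] //; case/andP: (spread_neq set0 a i x).
Qed.

Let color1_w i : color1 (w i) = if I i && (i != a) then i else spread set0 (other a i) (w i).
Proof.
by rewrite /color1; case: pickP => [j /eqP/w_inj ->|/(_ i)] //; rewrite eqxx.
Qed.

Let color1_w_neq i : ~~ I i -> color1 (w i) != i.
Proof. by rewrite color1_w => /negPf ->; case/andP: (spread_neq set0 a i (w i)). Qed.

Let color2_y i : ~~ I i -> color2 (y i) (w i) = i.
Proof.
move=> Ii; rewrite /color2; case: pickP => [j /and3P[_ /eqP/w_inj ->]|/(_ i)] //.
by rewrite Ii !eqxx.
Qed.

Let color2_spread i v : I i ->
  color2 v (w i) = spread (children (w i) u) (other a (color1 (w i))) v.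
Proof.
move=> Ii; rewrite /color2; case: pickP => // j /and3P[Ij /eqP/w_inj Eji].
by rewrite Eji Ii in Ij.
Qed.

Let color2_neq v x : color2 v x != color1 x.
Proof.
rewrite /color2; case: pickP => [i /and3P[Ii /eqP <- _]|_].
  by rewrite eq_sym color1_w_neq.
by case/andP: (spread_neq (children x u) a (color1 x) v).
Qed.

Lemma iris_b_coloring (phi : {ffun G -> 'I_m}) :
  girth_at_least G 10 -> proper_coloring phi -> b_colorable G m.+1.
Proof.
move=> gG phiP; have [|psi psiP psiC] := ball_coloring_extends (u := u) (C := color) gG phiP.
  move=> v p [|x [|x' [|? ?]]] _ _ // _; [exact: color1_neq_a|exact: color2_neq|].
  by have /andP[_ neq] := spread_neq (children p x) (color1 x) (color2 p x) v; exact: neq.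
have psi_u : psi u = a by exact: (psiC u [::]).
have psi_1 x : edge u x -> psi x = color1 x.
  by move=> ux; apply: (psiC x [:: u]) => //=; rewrite edge_sym ux.
have psi_2 x v : edge u x -> edge x v -> v != u -> psi v = color2 v x.
  move=> ux xv vu; apply: (psiC v [:: x; u]) => //=.
  by rewrite (edge_sym v) xv (edge_sym x) ux !andbT.
have psi_3 x v z : edge u x -> edge x v -> v != u -> edge v z -> z != x ->
    psi z = color3 z v x.
  move=> ux xv vu vz zx; apply: (psiC z [:: v; x; u]) => //=.
  apply/and3P; split=> //; first by rewrite edge_sym.
  apply/and3P; split=> //; first by rewrite edge_sym.
  by rewrite edge_sym ux.
apply/existsP; exists psi; rewrite /b_coloring psiP /=.
apply/forallP => i; apply/existsP; have [Ii|Ii] := boolP (I i); last first.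
  have [wyi yu] := wy Ii.
  have Ey : psi (y i) = i by rewrite (psi_2 (w i)) // color2_y.
  exists (y i); rewrite Ey eqxx; apply/forallP => c; apply/implyP; rewrite Ey => ci.
  apply/existsP; have [->|cw] := eqVneq c (color1 (w i)).
    by exists (w i); rewrite edge_sym wyi psi_1 /=.
  have yw : edge (y i) (w i) by rewrite edge_sym.
  have [v [yv vw Ev]] := children_onto yw (y_deg Ii) (color1_w_neq Ii) cw ci.
  by exists v; rewrite yv (psi_3 (w i) (y i)) // /color3 color2_y // Ev /=.
have [Eia|ia] := eqVneq i a.
  exists u; rewrite psi_u Eia eqxx; apply/forallP => c; apply/implyP; rewrite psi_u => ca.
  case: a_center => [|allI]; first by rewrite -Eia Ii.
  by apply/existsP; exists (w c); rewrite uw psi_1 // color1_w allI ca /=.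
have Ew : color1 (w i) = i by rewrite color1_w Ii ia.
have Epw : psi (w i) = i by rewrite psi_1.
exists (w i); rewrite Epw eqxx; apply/forallP => c; apply/implyP; rewrite Epw => ci.
apply/existsP; have [->|ca] := eqVneq c a.
  by exists u; rewrite edge_sym uw psi_u /=.
have wu : edge (w i) u by rewrite edge_sym.
have ai : a != i by rewrite eq_sym.
have [v [wv vu Ev]] := children_onto wu (w_deg Ii) ai ca ci.
by exists v; rewrite wv (psi_2 (w i)) // color2_spread // Ew Ev /=.
Qed.

End Iris.

(** * Removing a color class *)

(* A proper coloring with [k] colors plus the extra color [None], in which the
   b-vertices of the [k] colors are not required to see [None]. *)
Definition quasi_b_coloring (G : sgraph) k (f : G -> option 'I_k) : Prop :=
  (forall u v, edge u v -> f u != f v) /\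
  (forall i, exists2 x, f x = Some i &
     forall j, j != i -> exists2 v, edge x v & f v = Some j).

Lemma card_of_colors (T : finType) m (f : T -> option 'I_m.+1) (A : {set T}) i :
  (forall c, c != i -> exists2 v, v \in A & f v = Some c) -> m <= #|A|.
Proof.
move=> H; apply: leq_trans (leq_imset_card f A).
have {1}<- : #|[set Some c | c in [set~ i]]| = m.
  by rewrite card_imset ?cardsC1 ?card_ord //; exact: Some_inj.
apply/subset_leq_card/subsetP => _ /imsetP[c ci ->]; rewrite !inE in ci.
by have [v vA <-] := H c ci; apply: imset_f.
Qed.

(* A vertex [u] of color [None] can be given a color [i] once the neighbors of
   [u] of color [i] are recolored. This fails for every [i] only if [u] has k
   neighbors, one of each color, that either have large degree or are adjacent
   to a chosen b-vertex. *)
Lemma quasi_b_colorable (G : sgraph) m (f : G -> option 'I_m.+1) :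
  girth_at_least G 10 -> colorable G m -> quasi_b_coloring f -> b_colorable G m.+1.
Proof.
move=> gG /existsP[phi phiP].
have [n] := ubnP #|[set v | f v == None]|.
elim: n f => // n IH f; rewrite ltnS => fn [f_neq f_b].
have [x] := fin_all_exists (fun i => let: ex_intro2 x p q := f_b i in ex_intro _ x (conj p q)).
move=> /all_and2[fx xsees].
have x_deg j : m <= #|[set v | edge (x j) v]|.
  apply: (@card_of_colors _ _ f _ j) => c /xsees[v xv fv]; exists v => //.
  by rewrite inE.
(* The [x j] and their colored neighbors keep their colors, so the b-vertices survive while the
   class of [None] loses [u]. *)
have step g u : f u = None -> g u != None -> (forall v, f v != None -> g v != None) ->
    (forall v v', edge v v' -> g v != g v') -> (forall j, g (x j) = f (x j)) ->
    (forall j v, edge (x j) v -> f v != None -> g v = f v) -> b_colorable G m.+1.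
  move=> fu gu gN g_neq gx gxv; apply: (IH g).
    apply: leq_trans fn; apply: proper_card; apply/properP; split.
      by apply/subsetP => v; rewrite !inE; apply: contraLR; apply: gN.
    by exists u; rewrite !inE ?fu.
  split=> // i; exists (x i); rewrite ?gx // => j /xsees[v xv fv].
  by exists v; rewrite ?(gxv i) ?fv.
have [noN|[u fu]] : (forall v, f v != None) \/ exists u, f u = None.
  case: (pickP (fun v => f v == None)) => [u /eqP fu|no]; first by right; exists u.
  by left=> v; rewrite no.
  pose psi := [ffun v => odflt ord0 (f v)].
  have psif v : Some (psi v) = f v by rewrite ffunE; case: (f v) (noN v).
  have psiS v i : f v = Some i -> psi v = i by rewrite -psif => -[].
  apply/existsP; exists psi; apply/andP; split.
    apply/forallP => v; apply/forallP => v'; apply/implyP => /f_neq.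
    by rewrite -!psif; apply: contra_neq => ->.
  apply/forallP => i; apply/existsP; exists (x i); rewrite (psiS _ _ (fx i)) eqxx.
  apply/forallP => c; rewrite (psiS _ _ (fx i)); apply/implyP => /xsees[v xv /psiS fv].
  by apply/existsP; exists v; rewrite xv fv /=.
have xu j : x j != u by apply/eqP => E; move: (fx j); rewrite E fu.
(* These neighbors of [u] may resist recoloring: they may see all other colors, or some [x j] may
   rely on them. *)
pose ok i w := [&& edge u w, f w == Some i &
  (m <= #|[set v | edge w v]|) || [exists j, edge w (x j)]].
case: (boolP [forall i, exists w, ok i w]) => [/forallP oks|]; last first.
  rewrite negb_forall => /existsP[i /existsPn nok].
  have Wi_deg w : edge u w -> f w = Some i -> #|[set v | edge w v]| < m.
    by move=> uw /eqP fw; move: (nok w); rewrite /ok uw fw negb_or -ltnNge => /andP[].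
  have Wi_x w j : edge u w -> f w = Some i -> ~~ edge (x j) w.
    move=> uw /eqP fw; move: (nok w); rewrite /ok uw fw negb_or => /andP[_ /existsPn/(_ j)].
    by rewrite edge_sym.
  pose free w c := (c != i) && [forall v, edge w v ==> (f v != Some c)].
  pose miss w := odflt i [pick c | free w c].
  have missP w : edge u w -> f w = Some i -> free w (miss w).
    move=> uw fw; rewrite /miss; case: pickP => //= nofree.
    have := Wi_deg w uw fw; rewrite ltnNge => /negP[].
    apply: (@card_of_colors _ _ f _ i) => c ci.
    move/negbT: (nofree c); rewrite /free ci /= negb_forall => /existsP[v].
    by rewrite negb_imply negbK => /andP[wv /eqP fv]; exists v; rewrite ?inE.
  pose Wi v := edge u v && (f v == Some i).
  have WiP v : Wi v -> edge u v /\ f v = Some i by case/andP=> ? /eqP.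
  pose g v := if v == u then Some i else if Wi v then Some (miss v) else f v.
  have gu : g u = Some i by rewrite /g eqxx.
  have gE v : v != u -> ~~ Wi v -> g v = f v.
    by rewrite /g => /negPf -> /negPf ->.
  apply: (step g u) => //.
  - by rewrite gu.
  - by move=> v fv; rewrite /g; case: (v == u) => //; case: (Wi v).
  - have g_neq v v' : edge v v' -> v' != u -> ~~ Wi v' -> g v != g v'.
      move=> vv' v'u v'W; rewrite (gE v') // /g; have [vu|_] := eqVneq v u.
        by move: v'W; rewrite /Wi -vu vv' /= eq_sym.
      case: ifP => [/WiP[uv fv]|_]; last exact: f_neq.
      by have /andP[_ /forallP/(_ v')] := missP v uv fv; rewrite vv' eq_sym.
    move=> v v' vv'; have v'v : edge v' v by rewrite edge_sym.
    have [v'u|v'u] := eqVneq v' u; last first.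
      have [/WiP[uv' fv']|] := boolP (Wi v'); last exact: g_neq.
      have [vu|vu] := eqVneq v u.
        have /andP[mi _] := missP v' uv' fv'.
        rewrite vu gu /g (negPf v'u) /Wi uv' fv' eqxx /= eq_sym.
        by apply: contra_neq mi => -[].
      (* Two recolored vertices both had color [i], hence are not adjacent and cannot clash. *)
      rewrite eq_sym; apply: g_neq => //; apply/negP => /WiP[_ fv].
      by have := f_neq _ _ vv'; rewrite fv fv' eqxx.
    have vu : v != u by apply: contraTneq vv' => ->; rewrite v'u edge_irrefl.
    have [/WiP[uv fv]|] := boolP (Wi v); last by rewrite eq_sym; apply: g_neq.
    have /andP[mi _] := missP v uv fv.
    rewrite v'u gu /g (negPf vu) /Wi uv fv eqxx /=.
    by apply: contra_neq mi => -[].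
  - move=> j; apply: gE => //; apply/negP => /WiP[ux fxj].
    by have := Wi_deg _ ux fxj; rewrite ltnNge x_deg.
  - move=> j v xv fv; apply: gE => //; first by apply: contraNneq fv => ->; rewrite fu.
    by apply/negP => /WiP[uv fvi]; have := Wi_x v j uv fvi; rewrite xv.
have [w wP] := fin_all_exists (fun i => existsP (oks i)).
have uw i : edge u (w i) by case/and3P: (wP i).
have fw i : f (w i) = Some i by case/and3P: (wP i) => _ /eqP.
pose I i := m <= #|[set v | edge (w i) v]|.
pose y i := x (odflt i [pick j | edge (w i) (x j)]).
have m_gt1 : 1 < m.
  move: phiP => /forallP/(_ u)/forallP/(_ (w ord0))/implyP/(_ (uw _)).
  rewrite ltnNge; apply: contra => m_le1; apply/eqP/ord_inj.
  have phi0 v : phi v = 0 :> nat by have := ltn_ord (phi v); lia.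
  by rewrite !phi0.
have wI i : ~~ I i -> edge (w i) (y i) /\ y i != u.
  move=> /negPf Ii; rewrite /y; case: pickP => [j wx|no] /=; first by rewrite wx.
  case/and3P: (wP i) => _ _; rewrite -/(I i) Ii /= => /existsP[j].
  by rewrite no.
(* [u] gets color [a], so [w a] cannot: either [y a] takes it, or [u] is its b-vertex and needs
   every other [w c] to have color [c]. *)
have [a aP] : exists a, ~~ I a \/ forall i, I i.
  case: (boolP [forall i, I i]) => [/forallP allI|]; first by exists ord0; right.
  by rewrite negb_forall => /existsP[a Ia]; exists a; left.
apply: (iris_b_coloring (u := u) (I := I) (w := w) (y := y) (a := a) _ _ _ _ _ _ _ gG phiP) => //.
- by move=> i j E; apply: Some_inj; rewrite -!fw E.
- by move=> i _; apply: x_deg.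
Qed.

(** * Lowering the number of colors one at a time *)

(** The last of the m + 2 colors becomes [None]; b-vertices of the others still see all remaining
    colors. *)
Lemma b_colorable_pred (G : sgraph) m :
  girth_at_least G 10 -> colorable G m -> b_colorable G m.+2 -> b_colorable G m.+1.
Proof.
move=> gG cm /existsP[psi /andP[psiP /forallP psi_b]].
apply: (quasi_b_colorable (f := fun v => unlift ord_max (psi v)) gG cm); split.
  move=> u v uv; move: psiP => /forallP/(_ u)/forallP/(_ v)/implyP/(_ uv).
  case: unliftP => [i ->|->]; case: unliftP => [j ->|->] //; rewrite ?eqxx //.
  by rewrite (inj_eq lift_inj) (inj_eq Some_inj).
move=> i; have /existsP[x /andP[/eqP xi /forallP xb]] := psi_b (lift ord_max i).
exists x; rewrite ?xi ?liftK // => j ji.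
have := xb (lift ord_max j); rewrite xi (inj_eq lift_inj) ji => /existsP[v /andP[xv /eqP vj]].
by exists v; rewrite ?vj ?liftK.
Qed.

Theorem theorem1 (G : sgraph) (hG : girth_at_least G 10) : b_continuous G.
Proof.
move=> k /andP[chi_k k_b].
have b_col : b_colorable G (b_chromatic_number G).
  by rewrite /b_chromatic_number; case: ex_maxnP.
have colorable_ge j : chromatic_number G <= j -> colorable G j.
  rewrite /chromatic_number; case: ex_minnP => n /existsP[phi phiP] _ nj.
  apply/existsP; exists [ffun v => widen_ord nj (phi v)].
  apply/forallP => u; apply/forallP => v; apply/implyP => uv; rewrite !ffunE.
  move: phiP => /forallP/(_ u)/forallP/(_ v)/implyP/(_ uv).
  by apply: contra_neq => /(congr1 val) /= /val_inj.
have [d Ed] : exists d, b_chromatic_number G = k + d.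
  by exists (b_chromatic_number G - k); rewrite subnKC.
rewrite {}Ed {k_b} in b_col; elim: d => [|d IH] in k chi_k b_col *.
  by rewrite addn0 in b_col.
have bk : b_colorable G k.+1 by apply: IH; [exact: leqW|rewrite addSnnS].
(* At chi(G) a b-coloring always exists; above it, k - 1 colors suffice for the proper coloring that
   the reduction requires. *)
move: chi_k; rewrite leq_eqVlt => /predU1P[<-|]; first exact: chromatic_number_b_colorable.
case: k bk {b_col} => // m bm chi_m.
exact: b_colorable_pred (colorable_ge _ chi_m) bm.
Qed.
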